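(* Let $A$ be a commutative ring, and let $a, b \in A$. Assume that $a$ is a regular element of $A$ (a non-zero-divisor), and that the image $\bar{b}$ of $b$ in the ring $\bar{A} := A/(a)$ is a weakly proregular element of $\bar{A}$. Then the length $2$ sequence $\boldsymbol{a} := (a,b)$ in $A$ is weakly proregular.
   Context: Rings are not assumed noetherian. An element $a \in A$ is regular if multiplication by $a$ on $A$ is injective. Koszul complexes: for $a\in A$, $\operatorname{K}(A;a)$ is the complex $A \xrightarrow{a\cdot} A$ concentrated in degrees $-1, 0$. For $j\ge i$ in $\mathbb{N}$ there is a homomorphism of complexes $\mu_{j,i}:\operatorname{K}(A;a^j)\to \operatorname{K}(A;a^i)$ that is the identity in degree $0$ and multiplication by $a^{j-i}$ in degree $-1$. For a finite sequence $\boldsymbol{a}=(a_1,\ldots,a_n)$ in $A$, $\operatorname{K}(A;\boldsymbol{a}) := \operatorname{K}(A;a_1)\otimes_A\cdots\otimes_A \operatorname{K}(A;a_n)$ and $\boldsymbol{a}^i := (a_1^i,\ldots,a_n^i)$; the $\mu_{j,i}$ induce homomorphisms $\operatorname{K}(A;\boldsymbol{a}^j)\to\operatorname{K}(A;\boldsymbol{a}^i)$, making $\{\operatorname{K}(A;\boldsymbol{a}^i)\}_{i\in\mathbb{N}}$ an inverse system. An inverse system of modules $\{N_i\}_{i\in\mathbb{N}}$ is pro-zero if for every $i$ there is some $j\ge i$ such that $N_j\to N_i$ is zero. The sequence $\boldsymbol{a}$ is weakly proregular if for every $q<0$ the inverse system $\{\operatorname{H}^q(\operatorname{K}(A;\boldsymbol{a}^i))\}_{i\in\mathbb{N}}$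 is pro-zero. An element $a$ of a ring is weakly proregular if the length one sequence $(a)$ is weakly proregular. *)

(* Defs.v *)
From HB Require Import structures.
From mathcomp Require Import all_boot all_order all_algebra.
From mathcomp Require Import boolp.

Set Implicit Arguments.
Unset Strict Implicit.
Unset Printing Implicit Defensive.

Import Order.TTheory GRing.Theory Num.Theory.
Local Open Scope ring_scope.
Local Open Scope quotient_scope.

(* The library's quotient of a ring by an ideal requires a nontrivial ring and
   a proper ideal. Here A may be the zero ring and a may be a unit, so the ring
   structure on A / (a) is built on top of the quotient of the additive group. *)
Section PrincipalQuotient.
Variables (A : comPzRingType) (a : A).

Definition principal : {pred A} := fun x => `[< exists y, x = a * y >].

Lemma principalP x : reflect (exists y, x = a * y) (x \in principal).
Proof. exact: asboolP. Qed.

Fact principal_zmod_closed : zmod_closed principal.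
Proof.
split=> [|x y /principalP[x' ->] /principalP[y' ->]]; apply/principalP.
  by exists 0; rewrite mulr0.
by exists (x' - y'); rewrite mulrBr.
Qed.
HB.instance Definition _ :=
  GRing.isZmodClosed.Build A principal principal_zmod_closed.

Definition quot_ring := Quotient.quot principal.
HB.instance Definition _ := GRing.Zmodule.on quot_ring.

Definition quot_proj (x : A) : quot_ring := \pi_(Quotient.quot principal) x.

Lemma quot_projP x y :
  reflect (exists z, x - y = a * z) (quot_proj x == quot_proj y).
Proof.
rewrite /quot_proj -Quotient.idealrBE; exact: principalP.
Qed.

Lemma quot_proj_surj (u : quot_ring) : exists x, quot_proj x = u.
Proof. by exists (repr u); rewrite /quot_proj reprK. Qed.

Lemma quot_projD x y : quot_proj (x + y) = quot_proj x + quot_proj y.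
Proof. exact: (raddfD (\pi_(Quotient.quot principal))). Qed.

Definition quot_one : quot_ring := quot_proj 1.
Definition quot_mul (u v : quot_ring) : quot_ring :=
  quot_proj (repr u * repr v).

Lemma quot_proj_mul x y :
  quot_mul (quot_proj x) (quot_proj y) = quot_proj (x * y).
Proof.
have rP z : exists t, repr (quot_proj z) - z = a * t.
  by apply/quot_projP; rewrite /quot_proj reprK.
case: (rP x) (rP y) => [s sE] [t tE]; apply/eqP/quot_projP.
exists (s * repr (quot_proj y) + x * t).
rewrite mulrDr mulrA -sE mulrCA -tE mulrBl mulrBr addrA subrK.
by [].
Qed.

Fact quot_mulA : associative quot_mul.
Proof.
move=> u v w.
have [x <-] := quot_proj_surj u; have [y <-] := quot_proj_surj v; have [z <-] := quot_proj_surj w.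
by rewrite !quot_proj_mul mulrA.
Qed.

Fact quot_mulC : commutative quot_mul.
Proof.
move=> u v; have [x <-] := quot_proj_surj u; have [y <-] := quot_proj_surj v.
by rewrite !quot_proj_mul mulrC.
Qed.

Fact quot_mul1 : left_id quot_one quot_mul.
Proof.
move=> u; have [x <-] := quot_proj_surj u.
by rewrite quot_proj_mul mul1r.
Qed.

Fact quot_mulD : left_distributive quot_mul +%R.
Proof.
move=> u v w.
have [x <-] := quot_proj_surj u; have [y <-] := quot_proj_surj v; have [z <-] := quot_proj_surj w.
by rewrite -quot_projD !quot_proj_mul mulrDl quot_projD.
Qed.

HB.instance Definition _ := GRing.Zmodule_isComPzRing.Build quot_ring
  quot_mulA quot_mulC quot_mul1 quot_mulD.

Fact quot_proj_is_zmod_morphism : zmod_morphism quot_proj.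
Proof. exact: (raddfB (\pi_(Quotient.quot principal))). Qed.
Fact quot_proj_is_monoid_morphism : monoid_morphism quot_proj.
Proof. by split=> // x y; rewrite -quot_proj_mul. Qed.
HB.instance Definition _ :=
  GRing.isZmodMorphism.Build A quot_ring quot_proj quot_proj_is_zmod_morphism.
HB.instance Definition _ :=
  GRing.isMonoidMorphism.Build A quot_ring quot_proj quot_proj_is_monoid_morphism.

End PrincipalQuotient.

Section QuotientModule.
Variables (A : comPzRingType) (M : lmodType A) (N : {pred M}).
Variable N_submod : submod_closed N.

Definition submodule of submod_closed N : {pred M} := N.
HB.instance Definition _ :=
  GRing.isZmodClosed.Build M (submodule N_submod) (GRing.submod_closedB N_submod).

Definition quot_module := Quotient.quot (submodule N_submod).
HB.instance Definition _ := GRing.Zmodule.on quot_module.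

Definition mproj (x : M) : quot_module := \pi_(Quotient.quot (submodule N_submod)) x.

Lemma mprojP x y : (mproj x == mproj y) = (x - y \in N).
Proof. by rewrite /mproj -Quotient.idealrBE. Qed.

Lemma mproj_surj (u : quot_module) : exists x, mproj x = u.
Proof. by exists (repr u); rewrite /mproj reprK. Qed.

Lemma mprojK (u : quot_module) : mproj (repr u) = u.
Proof. by rewrite /mproj reprK. Qed.

Fact mproj_is_zmod_morphism : zmod_morphism mproj.
Proof. exact: (raddfB (\pi_(Quotient.quot (submodule N_submod)))). Qed.
HB.instance Definition _ :=
  GRing.isZmodMorphism.Build M quot_module mproj mproj_is_zmod_morphism.

Definition quot_scale (c : A) (u : quot_module) : quot_module :=
  mproj (c *: repr u).

Lemma mproj_scale c x : quot_scale c (mproj x) = mproj (c *: x).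
Proof.
apply/eqP; rewrite mprojP -scalerBr (GRing.subsemimod_closedZ N_submod) //.
by rewrite -mprojP mprojK.
Qed.

Fact quot_scaleA c d u : quot_scale c (quot_scale d u) = quot_scale (c * d) u.
Proof. by have [x <-] := mproj_surj u; rewrite !mproj_scale scalerA. Qed.
Fact quot_scale1 : left_id 1 quot_scale.
Proof. by move=> u; have [x <-] := mproj_surj u; rewrite mproj_scale scale1r. Qed.
Fact quot_scaleDr : right_distributive quot_scale +%R.
Proof.
move=> c u v; have [x <-] := mproj_surj u; have [y <-] := mproj_surj v.
by rewrite -raddfD !mproj_scale scalerDr raddfD.
Qed.
Fact quot_scaleDl u : {morph quot_scale^~ u : c d / c + d}.
Proof.
by move=> c d /=; have [x <-] := mproj_surj u; rewrite !mproj_scale scalerDl raddfD.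
Qed.
HB.instance Definition _ := GRing.Zmodule_isLmodule.Build A quot_module
  quot_scaleA quot_scale1 quot_scaleDr quot_scaleDl.

Fact mproj_is_scalable : scalable mproj.
Proof. by move=> c x; rewrite -mproj_scale. Qed.
HB.instance Definition _ :=
  GRing.isScalable.Build A M quot_module *:%R mproj mproj_is_scalable.

End QuotientModule.

(* Cochain complexes: diff p q is only meaningful for q = p + 1, and is zero
   otherwise; this avoids casts between obj (p - 1 + 1) and obj p. *)
Record complex (A : comPzRingType) := Complex {
  obj : int -> lmodType A;
  diff : forall p q, {linear obj p -> obj q};
  diff_shape : forall p q x, p + 1 != q -> diff p q x = 0;
  diff_diff : forall p q r x, diff q r (diff p q x) = 0 }.

Record complex_hom (A : comPzRingType) (C D : complex A) := ComplexHom {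
  hom_fun : forall q, {linear obj C q -> obj D q};
  hom_comm : forall p q x,
    diff D p q (hom_fun p x) = hom_fun q (diff C p q x) }.

Section Cohomology.
Variables (A : comPzRingType) (C : complex A) (q : int).

Definition cocycle_pred : {pred obj C q} := fun x => diff C q (q + 1) x == 0.

Fact cocycle_pred_submod : submod_closed cocycle_pred.
Proof.
split=> [|c x y /eqP xZ /eqP yZ]; apply/eqP; first exact: raddf0.
by rewrite linearP xZ yZ scaler0 addr0.
Qed.
HB.instance Definition _ :=
  GRing.isSubmodClosed.Build A (obj C q) cocycle_pred
    (GRing.submod_closed_semi cocycle_pred_submod).
HB.instance Definition _ :=
  GRing.isOppClosed.Build (obj C q) cocycle_pred
    (GRing.zmod_closedN (GRing.submod_closedB cocycle_pred_submod)).

Record cocycle := Cocycle { cocycle_val :> obj C q; _ : cocycle_val \in cocycle_pred }.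
HB.instance Definition _ := [isSub for cocycle_val].
HB.instance Definition _ := [Choice of cocycle by <:].
HB.instance Definition _ := [SubChoice_isSubLmodule of cocycle by <:].

Definition coboundary : {pred cocycle} :=
  fun z => `[< exists y : obj C (q - 1), diff C (q - 1) q y = val z >].

Lemma coboundaryP z :
  reflect (exists y : obj C (q - 1), diff C (q - 1) q y = val z)
          (z \in coboundary).
Proof. exact: asboolP. Qed.

Fact coboundary_submod : submod_closed coboundary.
Proof.
split=> [|c x y /coboundaryP[x' xE] /coboundaryP[y' yE]]; apply/coboundaryP.
  by exists 0; rewrite !raddf0.
by exists (c *: x' + y'); rewrite linearP xE yE linearP.
Qed.

Definition cohomology : lmodType A := quot_module coboundary_submod.

End Cohomology.

Arguments cocycle_pred {A} C q _.

Section CohomologyMap.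
Variables (A : comPzRingType) (C D : complex A) (f : complex_hom C D) (q : int).

Fact hom_cocycle (z : cocycle C q) : hom_fun f q (val z) \in cocycle_pred D q.
Proof.
have /eqP zZ := valP z.
by apply/eqP; rewrite hom_comm zZ raddf0.
Qed.

Definition cocycle_map (z : cocycle C q) : cocycle D q := Cocycle (hom_cocycle z).

Fact cocycle_map_linear : linear cocycle_map.
Proof. by move=> c x y; apply: val_inj; rewrite /= linearP. Qed.
HB.instance Definition _ :=
  GRing.isLinear.Build A _ _ _ cocycle_map cocycle_map_linear.

Definition cohomology_map (u : cohomology C q) : cohomology D q :=
  mproj (coboundary_submod D q) (cocycle_map (repr u)).

Lemma cohomology_map_proj (z : cocycle C q) :
  cohomology_map (mproj (coboundary_submod C q) z) =
  mproj (coboundary_submod D q) (cocycle_map z).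
Proof.
apply/eqP; rewrite mprojP -raddfB.
have /coboundaryP[y yE] :
    repr (mproj (coboundary_submod C q) z) - z \in @coboundary A C q.
  by rewrite -(mprojP (coboundary_submod C q)); apply/eqP; exact: mprojK.
by apply/coboundaryP; exists (hom_fun f _ y); rewrite hom_comm yE.
Qed.

Fact cohomology_map_linear : linear cohomology_map.
Proof.
move=> c u v; have [x <-] := mproj_surj u; have [y <-] := mproj_surj v.
by rewrite -linearP !cohomology_map_proj -linearP -linearP.
Qed.
HB.instance Definition _ :=
  GRing.isLinear.Build A _ _ _ cohomology_map cohomology_map_linear.

End CohomologyMap.

Record inverse_system (A : comPzRingType) := InverseSystem {
  isys_obj : nat -> lmodType A;
  isys_map : forall j i, (i <= j)%N -> {linear isys_obj j -> isys_obj i};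
  isys_map_id : forall i (le_ii : (i <= i)%N) x, isys_map le_ii x = x;
  isys_map_comp : forall k j i (le_ij : (i <= j)%N) (le_jk : (j <= k)%N)
      (le_ik : (i <= k)%N) x,
    isys_map le_ij (isys_map le_jk x) = isys_map le_ik x }.

Definition pro_zero (A : comPzRingType) (N : inverse_system A) : Prop :=
  forall i, exists j (le_ij : (i <= j)%N), forall x, isys_map N le_ij x = 0.

(* Complexes of finitely generated free modules with a finite homogeneous basis:
   the differential sends a basis element g to \sum_h bdiff g h *: h. For these
   the tensor product is explicit, since A^I (x) A^J = A^(I * J). *)
Record based_complex (A : comPzRingType) := BasedComplex {
  basis : finType;
  deg : basis -> int;
  bdiff : basis -> basis -> A;
  bdiff_deg : forall g h, deg g + 1 != deg h -> bdiff g h = 0;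
  bdiff_sq : forall g k, \sum_h bdiff g h * bdiff h k = 0 }.

Record based_hom (A : comPzRingType) (C D : based_complex A) := BasedHom {
  bhom : basis C -> basis D -> A;
  bhom_deg : forall g h, deg g != deg h -> bhom g h = 0;
  bhom_comm : forall g k,
    \sum_h bhom g h * bdiff h k = \sum_h bdiff g h * bhom h k }.

Section Realization.
Variable A : comPzRingType.

Definition bterm (C : based_complex A) (q : int) : lmodType A :=
  {ffun {g : basis C | deg g == q} -> A^o}.

Section Linear.
Variables (C D : based_complex A) (m : basis C -> basis D -> A) (p q : int).

Definition blin (x : bterm C p) : bterm D q :=
  [ffun h => \sum_g x g * m (val g) (val h)].

Fact blin_linear : linear blin.
Proof.
move=> c x y; apply/ffunP=> h; rewrite !ffunE scaler_sumr -big_split.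
by apply: eq_bigr => g _; rewrite !ffunE mulrDl; congr (_ + _); rewrite -mulrA.
Qed.
HB.instance Definition _ := GRing.isLinear.Build A _ _ _ blin blin_linear.
End Linear.

Lemma sum_deg (C : based_complex A) (V : nmodType) q (F : basis C -> V) :
  (forall g, deg g != q -> F g = 0) ->
  \sum_(g : {g : basis C | deg g == q}) F (val g) = \sum_g F g.
Proof.
move=> F0; rewrite [RHS](bigID (fun g => deg g == q)) /=.
rewrite [X in _ + X]big1 ?addr0; last by move=> g /F0.
rewrite (reindex_omap (val : {g : basis C | deg g == q} -> _) insub); last first.
  by move=> g gq; rewrite insubT.
by apply: eq_bigl => -[g gq] /=; rewrite insubT gq eqxx.
Qed.

Lemma blin_comp (C D E : based_complex A) m n p q r x :
  (forall g h, (deg g == p) -> deg h != q -> m g h = 0) ->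
  @blin D E n q r (@blin C D m p q x) =
  @blin C E (fun g k => \sum_h m g h * n h k) p r x.
Proof.
move=> m0; apply/ffunP=> k; rewrite !ffunE.
under eq_bigr do rewrite ffunE mulr_suml.
rewrite exchange_big; apply: eq_bigr => g _ /=.
rewrite -(sum_deg (q := q)); last by move=> h hq; rewrite m0 ?mul0r ?(valP g).
by rewrite mulr_sumr; apply: eq_bigr => h _; rewrite mulrA.
Qed.

Lemma eq_blin (C D : based_complex A) m n p q x :
  (forall g h, m g h = n g h) -> @blin C D m p q x = @blin C D n p q x.
Proof.
by move=> mn; apply/ffunP=> h; rewrite !ffunE; apply: eq_bigr => g _; rewrite mn.
Qed.

Lemma blin0 (C D : based_complex A) m p q x :
  (forall g h, (deg g == p) -> (deg h == q) -> m g h = 0) ->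
  @blin C D m p q x = 0.
Proof.
move=> m0; apply/ffunP=> h; rewrite !ffunE big1 // => g _.
by rewrite m0 ?mulr0 ?(valP g) ?(valP h).
Qed.

Definition bdiff_lin (C : based_complex A) p q : {linear bterm C p -> bterm C q} :=
  @blin C C (@bdiff A C) p q.

Fact bdiff_lin_shape C p q x : p + 1 != q -> @bdiff_lin C p q x = 0.
Proof.
move=> pq; apply: blin0 => g h /eqP gp /eqP hq.
by apply: bdiff_deg; rewrite gp hq.
Qed.

Fact bdiff_lin_sq C p q r x : @bdiff_lin C q r (@bdiff_lin C p q x) = 0.
Proof.
have [pq|/bdiff_lin_shape->] := eqVneq (p + 1) q; last exact: raddf0.
rewrite /bdiff_lin /= blin_comp; first by apply: blin0 => g k _ _; exact: bdiff_sq.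
by move=> g h /eqP gp hq; apply: bdiff_deg; rewrite gp pq eq_sym.
Qed.

Definition realization (C : based_complex A) : complex A :=
  Complex (@bdiff_lin_shape C) (@bdiff_lin_sq C).

Section Hom.
Variables (C D : based_complex A) (f : based_hom C D).

Definition bhom_lin q : {linear bterm C q -> bterm D q} :=
  @blin C D (bhom f) q q.

Fact bhom_lin_comm p q x :
  bdiff_lin D p q (bhom_lin p x) = bhom_lin q (bdiff_lin C p q x).
Proof.
have [pq|pq] := eqVneq (p + 1) q; last by rewrite !bdiff_lin_shape ?raddf0.
rewrite /bdiff_lin /bhom_lin /= !blin_comp.
- by apply: eq_blin => g k; exact: bhom_comm.
- by move=> g h /eqP gp hq; apply: bdiff_deg; rewrite gp pq eq_sym.
- by move=> g h /eqP gp hp; apply: bhom_deg; rewrite gp eq_sym.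
Qed.

Definition realization_hom : complex_hom (realization C) (realization D) :=
  @ComplexHom A (realization C) (realization D) bhom_lin bhom_lin_comm.

End Hom.
End Realization.

Section Tensor.
Variable A : comPzRingType.

Section Complex.
Variables C D : based_complex A.

Definition tensor_deg (u : basis C * basis D) : int := deg u.1 + deg u.2.

(* d (g (x) h) = d g (x) h + (-1)^(deg g) g (x) d h *)
Definition tensor_diff (u v : basis C * basis D) : A :=
  bdiff u.1 v.1 * (u.2 == v.2)%:R
  + (-1) ^+ `|deg u.1|%N * (u.1 == v.1)%:R * bdiff u.2 v.2.

Fact tensor_diff_deg u v : tensor_deg u + 1 != tensor_deg v -> tensor_diff u v = 0.
Proof.
case: u v => g h [g' h']; rewrite /tensor_deg /tensor_diff /= => uv.
have [eh|_] := eqVneq h h'; have [eg|_] := eqVneq g g'; rewrite ?mulr0 ?mul0r ?addr0 ?add0r //.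
- subst; rewrite !bdiff_deg ?mulr0 ?mul0r ?addr0 //.
    by rewrite -subr_eq0 addrAC subrr add0r oner_eq0.
  by rewrite -subr_eq0 addrAC subrr add0r oner_eq0.
- rewrite bdiff_deg ?mul0r //; apply: contraNneq uv => <-.
  by rewrite eh addrAC.
- rewrite bdiff_deg ?mulr0 //; apply: contraNneq uv => <-.
  by rewrite eg addrA.
Qed.

Lemma sign_step g g' :
  @bdiff A C g g' * (-1) ^+ `|deg g'|%N = - ((-1) ^+ `|deg g|%N * bdiff g g').
Proof.
have [gg|/bdiff_deg->] := eqVneq (deg g + 1) (deg g'); last first.
  by rewrite mul0r mulr0 oppr0.
rewrite -gg mulrC -mulNr; congr (_ * _).
rewrite -signr_odd -[in RHS]signr_odd.
have -> : odd `|deg g + 1| = ~~ odd `|deg g|.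
  case: (deg g) => [n|[|n]] //=; first by rewrite addn1.
  by rewrite ?subn1 /= ?negbK.
by case: odd; rewrite /= ?expr0 ?expr1 ?opprK.
Qed.

Lemma sum_pair (V : nmodType) (I J : finType) (F : I * J -> V) :
  \sum_v F v = \sum_i \sum_j F (i, j).
Proof. by rewrite (pair_bigA _ (fun i j => F (i, j))); apply: eq_bigr => -[]. Qed.

Lemma tensor_diff_suml u (F : basis C * basis D -> A) :
  \sum_v tensor_diff u v * F v =
  \sum_g bdiff u.1 g * F (g, u.2)
  + (-1) ^+ `|deg u.1|%N * \sum_h bdiff u.2 h * F (u.1, h).
Proof.
under eq_bigr do rewrite mulrDl; rewrite big_split /=; congr (_ + _).
  rewrite sum_pair /=.
  apply: eq_bigr => g _; rewrite (bigD1 u.2) //= eqxx mulr1 big1 ?addr0 // => h.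
  by rewrite eq_sym => /negPf->; rewrite mulr0 mul0r.
rewrite sum_pair /=.
rewrite (bigD1 u.1) //= [X in _ + X]big1 ?addr0 => [|g].
  by rewrite mulr_sumr; apply: eq_bigr => h _; rewrite eqxx mulr1 mulrA.
rewrite eq_sym => /negPf->; apply: big1 => h _.
by rewrite mulr0 !mul0r.
Qed.

Lemma tensor_diff_sumr w (F : basis C * basis D -> A) :
  \sum_v F v * tensor_diff v w =
  \sum_g F (g, w.2) * bdiff g w.1
  + (-1) ^+ `|deg w.1|%N * \sum_h F (w.1, h) * bdiff h w.2.
Proof.
under eq_bigr do rewrite mulrDr; rewrite big_split /=; congr (_ + _).
  rewrite sum_pair /=.
  apply: eq_bigr => g _; rewrite (bigD1 w.2) //= eqxx mulr1 big1 ?addr0 // => h.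
  by move=> /negPf->; rewrite !mulr0.
rewrite sum_pair /=.
rewrite (bigD1 w.1) //= [X in _ + X]big1 ?addr0 => [|g].
  by rewrite mulr_sumr; apply: eq_bigr => h _; rewrite eqxx mulr1 mulrCA.
move=> /negPf->; apply: big1 => h _.
by rewrite mulr0 mul0r mulr0.
Qed.

Fact tensor_diff_sq u w : \sum_v tensor_diff u v * tensor_diff v w = 0.
Proof.
rewrite tensor_diff_suml /tensor_diff /=.
under eq_bigr do rewrite mulrDr.
under [X in _ + _ * X]eq_bigr do rewrite mulrDr.
rewrite !big_split /= mulrDr.
under eq_bigr do rewrite mulrA.
rewrite -mulr_suml bdiff_sq mul0r add0r.
rewrite [X in _ + (_ + _ * X)](_ : _ = 0) ?mulr0 ?addr0; last first.
  under eq_bigr do rewrite mulrCA.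
  by rewrite -mulr_sumr bdiff_sq mulr0.
rewrite (bigD1 w.1) //= [X in _ + X + _]big1 => [|g /negPf->]; last first.
  by rewrite mulr0 mul0r mulr0.
rewrite (bigD1 w.2) //= [X in _ + _ * (_ + X)]big1 => [|h /negPf->]; last first.
  by rewrite !mulr0.
rewrite !eqxx !mulr1 !addr0 [bdiff u.1 w.1 * _]mulrA sign_step mulNr.
by rewrite [bdiff u.2 w.2 * _]mulrC mulrA addNr.
Qed.

Definition tensor : based_complex A :=
  BasedComplex tensor_diff_deg tensor_diff_sq.

End Complex.

Section Hom.
Variables (C C' D D' : based_complex A).
Variables (f : based_hom C C') (f' : based_hom D D').

Definition tensor_bhom (u : basis (tensor C D)) (v : basis (tensor C' D')) : A :=
  bhom f u.1 v.1 * bhom f' u.2 v.2.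

Fact tensor_bhom_deg u v : deg u != deg v -> tensor_bhom u v = 0.
Proof.
rewrite /tensor_bhom; case: u v => g h [g' h'] uv /=.
have [gg|/bhom_deg->] := eqVneq (deg g) (deg g'); last by rewrite mul0r.
rewrite (@bhom_deg _ _ _ f') ?mulr0 //; apply: contraNneq uv => hh.
by rewrite /= /tensor_deg /= gg hh.
Qed.

Fact tensor_bhom_comm u w :
  \sum_v tensor_bhom u v * bdiff v w = \sum_v bdiff u v * tensor_bhom v w.
Proof.
rewrite [LHS]tensor_diff_sumr [RHS]tensor_diff_suml /tensor_bhom /=.
congr (_ + _).
  under eq_bigr do rewrite mulrAC.
  rewrite -mulr_suml bhom_comm mulr_suml.
  by apply: eq_bigr => g _; rewrite mulrA.
have [gg|/bhom_deg f0] := eqVneq (deg u.1) (deg w.1); last first.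
  by rewrite !big1 ?mulr0 // => h _; rewrite f0 !(mul0r, mulr0).
rewrite gg; congr (_ * _).
under eq_bigr do rewrite -mulrA.
rewrite -mulr_sumr bhom_comm mulr_sumr.
by apply: eq_bigr => h _; rewrite mulrCA.
Qed.

Definition tensor_hom : based_hom (tensor C D) (tensor C' D') :=
  BasedHom tensor_bhom_deg tensor_bhom_comm.

End Hom.
End Tensor.

(* The tensor product is the usual one: in degree n it carries a bilinear map
   from bterm C p and bterm D q for all p + q = n, universal among such families,
   and the differential satisfies the Leibniz rule. *)
Section TensorUniversal.
Variable A : comPzRingType.

Definition coef (C : based_complex A) p (x : bterm C p) (g : basis C) : A :=
  oapp x 0 (insub g).

Definition bvec (C : based_complex A) p (g : basis C) : bterm C p :=
  [ffun g' => (val g' == g)%:R].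

Lemma coef_val (C : based_complex A) p (x : bterm C p) g : coef x (val g) = x g.
Proof. by rewrite /coef valK. Qed.

Lemma coef_deg (C : based_complex A) p (x : bterm C p) g :
  deg g != p -> coef x g = 0.
Proof. by move=> gp; rewrite /coef insubN. Qed.

Lemma coefE (C : based_complex A) p (x : bterm C p) g (gp : deg g == p) :
  coef x g = x (Sub g gp).
Proof. by rewrite /coef (insubT (fun g => deg g == p) gp). Qed.

Lemma coef_blin (C D : based_complex A) m p q (x : bterm C p) h :
  (forall g, deg g = p -> deg h != q -> m g h = 0) ->
  coef (@blin A C D m p q x) h = \sum_g coef x g * m g h.
Proof.
move=> m0; have [hq|hq] := boolP (deg h == q).
  rewrite coefE ffunE /= -(sum_deg (q := p)).
    by apply: eq_bigr => g _; rewrite coef_val.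
  by move=> g gp; rewrite coef_deg ?mul0r.
rewrite coef_deg // big1 // => g _.
have [gp|gp] := eqVneq (deg g) p; first by rewrite m0 ?mulr0.
by rewrite coef_deg ?mul0r.
Qed.

Definition pure_tensor (C D : based_complex A) p q n (x : bterm C p)
    (y : bterm D q) : bterm (tensor C D) n :=
  [ffun u => coef x (val u).1 * coef y (val u).2].

Lemma coef_pure_tensor (C D : based_complex A) p q n (x : bterm C p)
    (y : bterm D q) (u : basis (tensor C D)) :
  p + q = n -> coef (pure_tensor n x y) u = coef x u.1 * coef y u.2.
Proof.
move=> pq; have [un|un] := boolP (deg u == n); first by rewrite coefE ffunE.
rewrite coef_deg //; have [u1|/coef_deg->] := eqVneq (deg u.1) p; last first.
  by rewrite mul0r.
rewrite (coef_deg y) ?mulr0 //; apply: contraNneq un => u2.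
by rewrite -pq -u1 -u2.
Qed.

Lemma bterm_coefP (C : based_complex A) p (x y : bterm C p) :
  (forall g, coef x g = coef y g) -> x = y.
Proof. by move=> xy; apply/ffunP => g; rewrite -!coef_val. Qed.

Lemma pure_tensor_diff (C D : based_complex A) p q (x : bterm C p)
    (y : bterm D q) :
  bdiff_lin (tensor C D) (p + q) (p + q + 1) (pure_tensor (p + q) x y) =
  pure_tensor (p + q + 1) (bdiff_lin C p (p + 1) x) y
  + (-1) ^+ `|p|%N *: pure_tensor (p + q + 1) x (bdiff_lin D q (q + 1) y).
Proof.
apply/ffunP => u; rewrite -[LHS]coef_val coef_blin; last first.
  by move=> g gpq upq; apply: bdiff_deg; rewrite gpq eq_sym.
rewrite !ffunE !coef_blin; first last.
- by move=> g gp up; apply: bdiff_deg; rewrite gp eq_sym.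
- by move=> g gp up; apply: bdiff_deg; rewrite gp eq_sym.
under eq_bigr do rewrite coef_pure_tensor //.
rewrite [LHS]tensor_diff_sumr /=; congr (_ + _).
  by rewrite mulr_suml; apply: eq_bigr => g _; rewrite mulrAC.
under eq_bigr do rewrite -mulrA.
rewrite -mulr_sumr.
have [->//|/coef_deg->] := eqVneq (deg (val u).1) p.
by rewrite !mul0r scaler0 mulr0.
Qed.

Lemma pure_tensor_hom (C C' D D' : based_complex A) (f : based_hom C C')
    (f' : based_hom D D') p q (x : bterm C p) (y : bterm D q) :
  bhom_lin (tensor_hom f f') (p + q) (pure_tensor (p + q) x y) =
  pure_tensor (p + q) (bhom_lin f p x) (bhom_lin f' q y).
Proof.
apply/ffunP => u; rewrite -[LHS]coef_val coef_blin; last first.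
  by move=> g gpq upq; apply: bhom_deg; rewrite gpq eq_sym.
rewrite !ffunE !coef_blin; first last.
- by move=> g gp up; apply: bhom_deg; rewrite gp eq_sym.
- by move=> g gp up; apply: bhom_deg; rewrite gp eq_sym.
under eq_bigr do rewrite coef_pure_tensor //.
rewrite sum_pair big_distrlr /=.
by apply: eq_bigr => g _; apply: eq_bigr => h _; rewrite /tensor_bhom mulrACA.
Qed.

Lemma bterm_sum (C : based_complex A) p (x : bterm C p) :
  x = \sum_(g : {g : basis C | deg g == p}) x g *: bvec p (val g).
Proof.
apply/ffunP => g; rewrite sum_ffunE (bigD1 g) //= !ffunE eqxx big1 => [|h hg].
  by rewrite addr0 -[LHS]mulr1.
by rewrite !ffunE val_eqE eq_sym (negPf hg) scaler0.
Qed.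

Lemma bvec_tensor (C D : based_complex A) n (u : basis (tensor C D)) :
  deg u = n -> bvec n u = pure_tensor n (bvec (deg u.1) u.1) (bvec (deg u.2) u.2).
Proof.
move=> un; apply: bterm_coefP => v; rewrite coef_pure_tensor //.
have bvecE (E : based_complex A) (g h : basis E) :
  coef (bvec (deg g) g) h = (h == g)%:R.
  have [hg|hg] := boolP (deg h == deg g); first by rewrite coefE ffunE.
  by rewrite coef_deg //; case: (h =P g) hg => [->|] //; rewrite eqxx.
by rewrite -un !bvecE -natrM mulnb.
Qed.

Theorem tensor_universal (C D : based_complex A) (N : lmodType A) (n : int)
    (phi : forall p q, bterm C p -> bterm D q -> N) :
  (forall p q y, linear (fun x => phi p q x y)) ->
  (forall p q x, linear (phi p q x)) ->
  exists psi : {linear bterm (tensor C D) n -> N},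
    (forall p q x y, p + q = n -> psi (pure_tensor n x y) = phi p q x y) /\
    (forall psi' : {linear bterm (tensor C D) n -> N},
      (forall p q x y, p + q = n -> psi' (pure_tensor n x y) = phi p q x y) ->
      psi' =1 psi).
Proof.
move=> phil phir.
pose e (u : basis (tensor C D)) : N :=
  phi (deg u.1) (deg u.2) (bvec (deg u.1) u.1) (bvec (deg u.2) u.2).
pose psi (z : bterm (tensor C D) n) : N :=
  \sum_(u : {u : basis (tensor C D) | deg u == n}) z u *: e (val u).
have psil : linear psi.
  move=> c z w; rewrite /psi scaler_sumr -big_split; apply: eq_bigr => u _.
  by rewrite !ffunE scalerDl scalerA.
pose L := GRing.isLinear.Build A _ _ _ psi psil.
pose psiL : {linear bterm (tensor C D) n -> N} := HB.pack psi L.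
exists psiL; split=> [p q x y pq|psi' psi'E z].
  pose xl y := HB.pack_for {linear bterm C p -> N} (fun x => phi p q x y)
    (GRing.isLinear.Build A _ _ _ (fun x => phi p q x y) (phil p q y)).
  pose yl x := HB.pack_for {linear bterm D q -> N} (phi p q x)
    (GRing.isLinear.Build A _ _ _ (phi p q x) (phir p q x)).
  have phiE : phi p q x y = \sum_(g : {g : basis C | deg g == p})
      \sum_(h : {h : basis D | deg h == q})
        (coef x (val g) * coef y (val h)) *: e (val g, val h).
    rewrite [in LHS](bterm_sum x) -[LHS]/(xl y _) linear_sum.
    apply: eq_bigr => g _; rewrite linearZ /= [in LHS](bterm_sum y).
    rewrite -[phi _ _ _ _]/(yl _ _) linear_sum scaler_sumr.
    apply: eq_bigr => h _; rewrite linearZ /= scalerA !coef_val.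
    by rewrite /e /= (eqP (valP g)) (eqP (valP h)).
  rewrite phiE /= /psi.
  transitivity (\sum_(u : basis (tensor C D)) (coef x u.1 * coef y u.2) *: e u).
    rewrite -(sum_deg (q := n)) => [|u un].
      by apply: eq_bigr => u _; rewrite ffunE.
    by rewrite -(coef_pure_tensor x y u pq) coef_deg ?scale0r.
  rewrite (sum_pair (fun u => (coef x u.1 * coef y u.2) *: e u)) /=.
  rewrite (sum_deg (F := fun g => \sum_(h : {h : basis D | deg h == q})
        (coef x g * coef y (val h)) *: e (g, val h))) => [|g gp]; last first.
    by apply: big1 => h _; rewrite coef_deg ?mul0r ?scale0r.
  apply: eq_bigr => g _.
  rewrite (sum_deg (F := fun h => (coef x g * coef y h) *: e (g, h))) // => h hq.
  by rewrite (coef_deg y) ?mulr0 ?scale0r.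
rewrite [in LHS](bterm_sum z) linear_sum; apply: eq_bigr => u _.
by rewrite linearZ /= (bvec_tensor (eqP (valP u))) psi'E //; exact: eqP (valP u).
Qed.

End TensorUniversal.

Section Koszul.
Variable A : comPzRingType.

Definition unit_complex : based_complex A.
Proof.
refine (@BasedComplex A unit (fun=> 0) (fun _ _ => 0) _ _) => // *.
by rewrite big1 // => *; rewrite mulr0.
Defined.

Section One.
Variable x : A.

(* The basis element true has degree -1, false has degree 0. *)
Definition koszul1_deg (g : bool) : int := if g then -1 else 0.
Definition koszul1_diff (g h : bool) : A := if g && ~~ h then x else 0.

Fact koszul1_diff_deg g h : koszul1_deg g + 1 != koszul1_deg h ->
  koszul1_diff g h = 0.
Proof. by case: g h => [] []. Qed.

Fact koszul1_diff_sq g k : \sum_h koszul1_diff g h * koszul1_diff h k = 0.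
Proof. by rewrite big_bool; case: g k => [] []; rewrite /koszul1_diff /= !(mul0r, mulr0, addr0). Qed.

Definition koszul1 : based_complex A :=
  BasedComplex koszul1_diff_deg koszul1_diff_sq.

End One.

Section MuOne.
Variables (x : A) (j i : nat).
Variable le_ij : (i <= j)%N.

Definition mu1_fun (g h : bool) : A :=
  if g == h then (if g then x ^+ (j - i) else 1) else 0.

Fact mu1_deg g h : koszul1_deg g != koszul1_deg h -> mu1_fun g h = 0.
Proof. by case: g h => [] []. Qed.

Fact mu1_comm g k :
  \sum_h mu1_fun g h * koszul1_diff (x ^+ i) h k =
  \sum_h koszul1_diff (x ^+ j) g h * mu1_fun h k.
Proof.
rewrite !big_bool; case: g k => [] [];
  rewrite /mu1_fun /koszul1_diff /= !(mul0r, mulr0, addr0, add0r) //.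
by rewrite mulr1 -exprD subnK.
Qed.

Definition mu1 : based_hom (koszul1 (x ^+ j)) (koszul1 (x ^+ i)) :=
  @BasedHom A (koszul1 (x ^+ j)) (koszul1 (x ^+ i)) mu1_fun mu1_deg mu1_comm.

End MuOne.

Fixpoint koszul_cons (x : A) (s : seq A) : based_complex A :=
  if s is y :: s' then tensor (koszul1 x) (koszul_cons y s') else koszul1 x.

Definition koszul (s : seq A) : based_complex A :=
  if s is x :: s' then koszul_cons x s' else unit_complex.

Definition powers (s : seq A) (i : nat) : seq A := [seq x ^+ i | x <- s].

Fact unit_hom_deg (g h : unit) : 0 != 0 :> int -> (1 : A) = 0.
Proof. by rewrite eqxx. Qed.
Fact unit_hom_comm (g k : basis unit_complex) :
  \sum_h 1 * bdiff h k = \sum_h bdiff g h * 1 :> A.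
Proof. by rewrite !big1 // => *; rewrite ?mulr0 ?mul0r. Qed.
Definition unit_hom : based_hom unit_complex unit_complex :=
  @BasedHom A unit_complex unit_complex (fun _ _ => 1) unit_hom_deg unit_hom_comm.

Fixpoint mu_cons j i (le_ij : (i <= j)%N) (x : A) (s : seq A) :
    based_hom (koszul_cons (x ^+ j) (powers s j))
              (koszul_cons (x ^+ i) (powers s i)) :=
  match s with
  | [::] => mu1 x le_ij
  | y :: s' => tensor_hom (mu1 x le_ij) (mu_cons le_ij y s')
  end.

Definition mu j i (le_ij : (i <= j)%N) (s : seq A) :
    based_hom (koszul (powers s j)) (koszul (powers s i)) :=
  match s with
  | [::] => unit_hom
  | x :: s' => mu_cons le_ij x s'
  end.

Definition is_id (C : based_complex A) (f : based_hom C C) :=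
  forall g h, bhom f g h = (g == h)%:R.

Definition is_comp (C D E : based_complex A) (f : based_hom C D)
    (f' : based_hom D E) (f'' : based_hom C E) :=
  forall g k, \sum_h bhom f g h * bhom f' h k = bhom f'' g k.

Lemma tensor_is_id C D (f : based_hom C C) (f' : based_hom D D) :
  is_id f -> is_id f' -> is_id (tensor_hom f f').
Proof.
move=> fE f'E [g h] [g' h']; rewrite /= /tensor_bhom fE f'E /=.
by rewrite -natrM mulnb xpair_eqE.
Qed.

Lemma tensor_is_comp C D E C' D' E'
    (f : based_hom C D) (f' : based_hom D E) (f'' : based_hom C E)
    (g : based_hom C' D') (g' : based_hom D' E') (g'' : based_hom C' E') :
  is_comp f f' f'' -> is_comp g g' g'' ->
  is_comp (tensor_hom f g) (tensor_hom f' g') (tensor_hom f'' g'').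
Proof.
move=> fE gE u w; rewrite /= /tensor_bhom -fE -gE big_distrlr /= sum_pair /=.
by apply: eq_bigr => ? _; apply: eq_bigr => ? _; rewrite mulrACA.
Qed.

Lemma mu_id i (le_ii : (i <= i)%N) s : is_id (mu le_ii s).
Proof.
have mu1E x : is_id (mu1 x le_ii).
  by move=> [] []; rewrite /= /mu1_fun ?subnn.
case: s => [|x s] /=; first by case=> -[].
by elim: s x => [|y s IHs] x //=; exact: tensor_is_id.
Qed.

Lemma mu_comp k j i (le_ij : (i <= j)%N) (le_jk : (j <= k)%N)
    (le_ik : (i <= k)%N) s :
  is_comp (mu le_jk s) (mu le_ij s) (mu le_ik s).
Proof.
have mu1E x : is_comp (mu1 x le_jk) (mu1 x le_ij) (mu1 x le_ik).
  move=> g h; rewrite big_bool /= /mu1_fun.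
  case: g h => [] []; rewrite /= ?(mul0r, mulr0, addr0, add0r, mulr1) //.
  by rewrite -exprD addnBA // subnK.
case: s => [|x s] /=.
  by move=> [] []; rewrite (big_pred1 tt) ?mulr1 // => -[].
by elim: s x => [|y s IHs] x //=; exact: tensor_is_comp.
Qed.

Lemma realization_id (C : based_complex A) (f : based_hom C C) q
    (u : cohomology (realization C) q) :
  is_id f -> cohomology_map (realization_hom f) u = u.
Proof.
move=> fE; have [z <-] := mproj_surj u; rewrite cohomology_map_proj.
congr (mproj _ _); apply: val_inj; apply/ffunP => h; rewrite ffunE.
rewrite (bigD1 h) //= fE eqxx mulr1 big1 ?addr0 // => g.
by rewrite fE -val_eqE => /negPf->; rewrite mulr0.
Qed.

Lemma realization_comp (C D E : based_complex A) (f : based_hom C D)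
    (f' : based_hom D E) (f'' : based_hom C E) q
    (u : cohomology (realization C) q) :
  is_comp f f' f'' ->
  cohomology_map (realization_hom f') (cohomology_map (realization_hom f) u)
  = cohomology_map (realization_hom f'') u.
Proof.
move=> fE; have [z <-] := mproj_surj u; rewrite !cohomology_map_proj.
congr (mproj _ _); apply: val_inj; rewrite /= /bhom_lin /= blin_comp.
  exact: eq_blin.
by move=> g h /eqP gq hq; apply: bhom_deg; rewrite gq eq_sym.
Qed.

Definition koszul_cohomology (s : seq A) (q : int) : inverse_system A :=
  @InverseSystem A (fun i => cohomology (realization (koszul (powers s i))) q)
    (fun j i le_ij => @cohomology_map A _ _ (realization_hom (mu le_ij s)) q)
    (fun i le_ii u => realization_id u (@mu_id i le_ii s))
    (fun k j i le_ij le_jk le_ik u =>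
       realization_comp u (@mu_comp k j i le_ij le_jk le_ik s)).

Definition weakly_proregular (s : seq A) : Prop :=
  forall q : int, q < 0 -> pro_zero (koszul_cohomology s q).

Definition weakly_proregular_elt (x : A) : Prop := weakly_proregular [:: x].

End Koszul.

(* Main.v *)
(* Weak proregularity of b modulo a yields one exponent c such that b^m v in (a)
   implies b^c v in (a), whatever m is. As a is regular, this lifts to powers:
   b^m v in (a^n) implies b^(n c) v in (a^n). Since a^i is regular, H^-2 vanishes
   and a class (u, v) of H^-1, where a^j u + b^j v = 0, is determined by v with
   b^j v in (a^j); so H^-1 at level i + i c maps to zero at level i. *)
Require Import Defs.
From mathcomp Require Import all_boot all_algebra.
Import GRing.Theory.

Set Implicit Arguments.
Unset Strict Implicit.
Unset Printing Implicit Defensive.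

Local Open Scope ring_scope.

Lemma cohomology_map_eq0P (A : comPzRingType) (C D : complex A)
    (f : complex_hom C D) (q : int) :
  (forall u, cohomology_map f (q := q) u = 0) <->
  (forall z : obj C q, diff C q (q + 1) z = 0 ->
     exists y : obj D (q - 1), diff D (q - 1) q y = hom_fun f q z).
Proof.
split=> [f0 z /eqP zZ | f0 u].
  pose c : cocycle C q := Cocycle zZ.
  have /eqP := f0 (mproj (coboundary_submod C q) c).
  rewrite cohomology_map_proj -(raddf0 (mproj (coboundary_submod D q))) mprojP.
  by rewrite subr0 => /coboundaryP.
have [z <-] := mproj_surj u; have /eqP/f0[y yE] := valP z.
apply/eqP; rewrite cohomology_map_proj.
rewrite -(raddf0 (mproj (coboundary_submod D q))) mprojP subr0.
by apply/coboundaryP; exists y.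
Qed.

Section BasedCohomology.
Variable A : comPzRingType.

Definition supported (C : based_complex A) (q : int) (x : basis C -> A) :=
  forall g, deg g != q -> x g = 0.

Lemma coef_supported (C : based_complex A) q (x : bterm C q) :
  supported q (coef x).
Proof. by move=> g; exact: coef_deg. Qed.

Definition bterm_of (C : based_complex A) q (x : basis C -> A) : bterm C q :=
  [ffun g => x (val g)].

Lemma coef_bterm_of (C : based_complex A) q (x : basis C -> A) :
  supported q x -> coef (bterm_of q x) =1 x.
Proof.
move=> xq g; have [gq|gq] := boolP (deg g == q); first by rewrite Defs.coefE ffunE.
by rewrite coef_deg // xq.
Qed.

Lemma coef_bdiff_lin (C : based_complex A) p q (x : bterm C p) k :
  p + 1 = q -> coef (bdiff_lin C p q x) k = \sum_g coef x g * bdiff g k.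
Proof.
move=> pq; apply: coef_blin => g gp kq.
by apply: bdiff_deg; rewrite gp pq eq_sym.
Qed.

Lemma coef_bhom_lin (C D : based_complex A) (f : based_hom C D) q
    (x : bterm C q) k :
  coef (bhom_lin f q x) k = \sum_g coef x g * bhom f g k.
Proof.
by apply: coef_blin => g gq kq; apply: bhom_deg; rewrite gq eq_sym.
Qed.

(** Extending coefficients by zero outside degree [q] turns the vanishing of the cohomology map into
    identities between finite sums over whole bases, free of degree-indexed types. *)
Lemma realization_hom_eq0P (C D : based_complex A) (f : based_hom C D) q :
  (forall u, cohomology_map (realization_hom f) (q := q) u = 0) <->
  (forall x : basis C -> A, supported q x ->
     (forall k, \sum_g x g * bdiff g k = 0) ->
     exists2 y : basis D -> A, supported (q - 1) y &
       forall k, \sum_g y g * bdiff g k = \sum_g x g * bhom f g k).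
Proof.
rewrite cohomology_map_eq0P; split=> f0 x.
  move=> xq dx0; have xE := coef_bterm_of xq.
  case: (f0 (bterm_of q x)) => [|y yE].
    apply: bterm_coefP => k; rewrite coef_bdiff_lin //.
    under eq_bigr do rewrite xE.
    by rewrite dx0 /coef; case: insub => //= ?; rewrite ffunE.
  exists (coef y) => [|k]; first exact: coef_supported.
  rewrite -(@coef_bdiff_lin _ (q - 1) q) ?subrK // [bdiff_lin _ _ _ _]yE.
  by rewrite coef_bhom_lin; apply: eq_bigr => g _; rewrite xE.
move=> dx0; case: (f0 (coef x)) => [|k|y yq yE]; first exact: coef_supported.
  rewrite -(@coef_bdiff_lin _ q (q + 1)) // [bdiff_lin _ _ _ _]dx0.
  by rewrite /coef; case: insub => //= ?; rewrite ffunE.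
exists (bterm_of (q - 1) y); apply: bterm_coefP => k.
rewrite coef_bdiff_lin ?subrK // coef_bhom_lin -yE.
by apply: eq_bigr => g _; rewrite coef_bterm_of.
Qed.

End BasedCohomology.

(** As there is nothing in degree -2, H^-1 of [koszul1 (x ^+ j)] is the annihilator of [x ^+ j]; the
    transition map to level [i] multiplies it by [x ^+ (j - i)]. *)
Lemma weakly_proregular_elt_ann (A : comPzRingType) (x : A) :
  weakly_proregular_elt x ->
  forall i, exists2 j, (i <= j)%N &
    forall v, v * x ^+ j = 0 -> v * x ^+ (j - i) = 0.
Proof.
move=> /(_ (-1) isT) x_wpr i; have [j [le_ij xj0]] := x_wpr i.
exists j => // v vx0.
have [|k|y yq] := (realization_hom_eq0P _ _).1 xj0
  (fun g : bool => if g then v else 0).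
- by case.
- by rewrite big_bool /= /koszul1_diff; case: k; rewrite /= ?vx0 mul0r ?mulr0 addr0.
move=> /(_ true); rewrite !big_bool /= /mu1_fun /= !yq //.
by rewrite !mul0r !addr0.
Qed.

Section RegularModulo.
Variables (A : comPzRingType) (a b : A).
Hypothesis a_reg : GRing.lreg a.

(** In A/(a) the annihilators of the powers of [b] form an ascending chain, and two equal
    consecutive terms make it constant from there on. *)
Lemma pow_saturation_modulo :
  weakly_proregular_elt (quot_proj a b : quot_ring a) ->
  exists c, forall m v w, b ^+ m * v = a * w -> exists w', b ^+ c * v = a * w'.
Proof.
(* Level 1 suffices: its [j] is some [c.+1], and [j - 1 = c] makes the annihilators of the powers
   [c.+1] and [c] agree. *)
move=> /weakly_proregular_elt_ann /(_ 1%N)[[//|c] _ b_ann]; exists c.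
have projE0 x : (quot_proj a x = 0) <-> exists w, x = a * w.
  split=> [x0 | [w xE]].
    have /quot_projP[w wE] : quot_proj a x == quot_proj a 0 by rewrite x0 raddf0.
    by exists w; rewrite -wE subr0.
  rewrite -[RHS](raddf0 (quot_proj a)); apply/eqP/quot_projP.
  by exists w; rewrite subr0.
have step v : (exists w, b ^+ c.+1 * v = a * w) -> exists w, b ^+ c * v = a * w.
  move=> /projE0 v0; apply/projE0.
  have := b_ann (quot_proj a v); rewrite subn1 -!rmorphXn -!rmorphM /=.
  by rewrite ![v * _]mulrC; apply.
move=> m v w vE; have [le_mc|lt_cm] := leqP m c.
  by exists (b ^+ (c - m) * w); rewrite -{1}(subnK le_mc) exprD -mulrA vE mulrCA.
elim: m v w lt_cm vE => // m IHm v w; rewrite ltnS => le_cm vE.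
have [w' w'E] : exists w', b ^+ m * v = a * w'.
  have [|w' w'E] := step (b ^+ (m - c) * v).
    by exists w; rewrite mulrA -exprD addSn subnKC.
  by exists w'; rewrite -w'E mulrA -exprD subnKC.
move: le_cm; rewrite leq_eqVlt => /predU1P[->|lt_cm]; first by exists w'.
exact: IHm lt_cm w'E.
Qed.

(** Induction on [n]: once [b ^+ (n * c) * v = a ^+ n * w1], cancelling the regular [a ^+ n] puts
    [b ^+ m * w1] in (a), and the hypothesis on [c] gains one more factor [a] at the cost of
    [b ^+ c]. *)
Lemma pow_saturation c :
  (forall m v w, b ^+ m * v = a * w -> exists w', b ^+ c * v = a * w') ->
  forall n m v w, b ^+ m * v = a ^+ n * w ->
    exists w', b ^+ (n * c) * v = a ^+ n * w'.
Proof.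
move=> sat; elim=> [|n IHn] m v w vE.
  by exists v; rewrite mul0n !expr0.
have [|w1 w1E] := IHn m v (a * w); first by rewrite mulrA -exprSr.
have [|w2 w2E] := sat m w1 (b ^+ (n * c) * w).
  apply: (lregX (n := n) a_reg); rewrite mulrCA -w1E mulrCA vE exprSr -mulrA mulrCA.
  by congr (_ * _); rewrite mulrCA.
by exists w2; rewrite mulSn exprD -mulrA w1E mulrCA w2E exprSr mulrA.
Qed.

End RegularModulo.

Theorem theorem0p5 (A : comPzRingType) (a b : A)
    (a_reg : GRing.lreg a)
    (b_wpr : weakly_proregular_elt (quot_proj a b : quot_ring a)) :
  weakly_proregular [:: a; b].
Proof.
have [c /(pow_saturation a_reg) sat] := pow_saturation_modulo b_wpr.
move=> q q_lt0 i; have le_ij := leq_addr (i * c) i.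
(* With this level the transition map multiplies the [(false, true)] coordinate by [b ^+ (i * c)],
   the power that [sat] requires for [n = i]. *)
exists (i + i * c)%N, le_ij; apply/realization_hom_eq0P => x xq dx0.
set j := (i + i * c)%N in le_ij x xq dx0 *.
have dxE k : \sum_(g : bool) x (g, k.2) * koszul1_diff (a ^+ j) g k.1
    + (-1) ^+ `|koszul1_deg k.1|%N
      * \sum_(h : bool) x (k.1, h) * koszul1_diff (b ^+ j) h k.2 = 0.
  by rewrite -[RHS](dx0 k); symmetry; exact: tensor_diff_sumr.
(* These components of the cocycle equation are [x (true, true) * a ^+ j = 0] and, with [u] and [v]
   as below, [u * a ^+ j + v * b ^+ j = 0]. *)
move: (dxE (false, true)) (dxE (false, false)).
rewrite !big_bool /koszul1_diff /= !(mulr0, add0r, addr0, mul1r).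
move=> xtt0 cycE.
have {}xtt0 : x (true, true) = 0.
  by apply: (lregX (n := j) a_reg); rewrite mulr0 mulrC.
have xff0 : x (false, false) = 0.
  by apply: xq; apply: contraTneq q_lt0 => <-.
(* Outside degree -1 the cocycle itself is zero. *)
have [q1|q_neq1] := eqVneq q (-1); last first.
  have x0 g : x g = 0.
    by case: g => [] [] [] //; apply: xq; rewrite eq_sym.
  exists (fun=> 0) => // k.
  by rewrite !big1 // => g _; rewrite ?x0 mul0r.
set u := x (true, false) in cycE; set v := x (false, true) in cycE.
have j_i : (j - i = i * c)%N by rewrite /j addKn.
have [|w wE] := sat i j v (- (a ^+ (i * c) * u)).
  rewrite mulrN mulrA -exprD -/j; apply/eqP; rewrite -addr_eq0 addrC.
  by rewrite [a ^+ j * _]mulrC [b ^+ j * _]mulrC cycE.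
(* Insert [wE] into the cocycle equation and cancel [a ^+ i]; the minus sign is that of the tensor
   differential. *)
have uE : u * a ^+ (i * c) = - (w * b ^+ i).
  apply: (lregX (n := i) a_reg); rewrite mulrN [w * _]mulrC [a ^+ i * (b ^+ i * w)]mulrCA.
  rewrite -wE [b ^+ i * _]mulrA mulrCA -!exprD -/j.
  by apply/eqP; rewrite -addr_eq0 [b ^+ j * _]mulrC cycE.
(* The image of (u, v) is the boundary of w times the generator of degree -2. *)
exists (fun g => if g.1 && g.2 then w else 0) => [|k].
  by rewrite q1; case=> [] [] [].
rewrite (tensor_diff_sumr (C := koszul1 (a ^+ i)) (D := koszul1 (b ^+ i))).
rewrite !sum_pair !big_bool /= /tensor_bhom /koszul1_diff /= /mu1_fun.
rewrite j_i xtt0 xff0 -/u -/v.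
case: k => [] [] [] /=;
  rewrite !(mulr0, mul0r, mulr1, mul1r, addr0, add0r) ?mulN1r //.
by rewrite mulrC -wE mulrC.
Qed.
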